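(* There exists a universal constant $C>0$ such that the following holds. For $k\ge1$ and $d\ge4$, let $F_1=F_2=\cdots=F_k$ be the collection of all affine functions $x\mapsto w\cdot x+b$ ($w\in\mathbb{R}^d$, $b\in\mathbb{R}$) over $\Omega=\mathbb{R}^d$, and let $G_{\max}(F_1,\ldots,F_k)$ be their $k$-fold maximum. Then for all $\gamma>0$, $$\mathrm{fat}_\gamma(G_{\max}(F_1,\ldots,F_k))\ \ge\ C\log(k)\sum_{i=1}^k\mathrm{fat}_\gamma(F_i)\ \ge\ C\,d\,k\log k.$$
   Context: $\log$ is the natural logarithm. The $k$-fold maximum is $$G_{\max}(F_1,\ldots,F_k):=\{x\mapsto \max_{i\in\{1,\ldots,k\}} f_i(x) : f_i\in F_i\}.$$ Fat-shattering dimension: for $F\subset\mathbb{R}^\Omega$ and $\gamma>0$, a finite set $S=\{x_1,\ldots,x_m\}\subset\Omega$ is $\gamma$-shattered by $F$ if $$\sup_{r\in\mathbb{R}^m}\ \min_{y\in\{-1,1\}^m}\ \sup_{f\in F}\ \min_{i\in\{1,\ldots,m\}} y_i(f(x_i)-r_i)\ \ge\ \gamma,$$ and $\mathrm{fat}_\gamma(F)$ is the size of the largest $\gamma$-shattered set (possibly $\infty$). *)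

(* Defs.v *)
From HB Require Import structures.
From mathcomp Require Import all_boot all_order all_algebra.
From mathcomp Require Import all_classical all_reals all_analysis.

Set Implicit Arguments.
Unset Strict Implicit.
Unset Printing Implicit Defensive.

Import Order.TTheory GRing.Theory Num.Theory.

Local Open Scope classical_set_scope.
Local Open Scope ring_scope.

(* The sign vector in {-1,1}^m is (-1) ^+ y i with y : {ffun 'I_m -> bool}.
   All suprema and minima are taken in \bar R: the suprema may be infinite, and
   a minimum over no index is +oo, so the empty set is shattered by any
   nonempty F. *)
Definition shatter_margin (R : realType) (T : Type) (F : set (T -> R))
    (m : nat) (x : 'I_m -> T) : \bar R :=
  ereal_sup (range (fun r : 'I_m -> R =>
    \big[mine/+oo%E]_(y : {ffun 'I_m -> bool})
      ereal_sup [set \big[mine/+oo%E]_(i < m)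
                       ((-1) ^+ y i * (f (x i) - r i))%:E | f in F])).

Definition shattered (R : realType) (T : Type) (F : set (T -> R)) (gamma : R)
    (m : nat) (x : 'I_m -> T) : Prop :=
  (gamma%:E <= shatter_margin F x)%E.

(* A finite set of size m is presented by an injective enumeration; the value
   is +oo when there are shattered sets of unbounded size. *)
Definition fat (R : realType) (T : Type) (gamma : R) (F : set (T -> R))
    : \bar R :=
  ereal_sup [set (m%:R)%:E | m in
    [set m : nat | exists x : 'I_m -> T, injective x /\ shattered F gamma x]].

(* For 0 < k the set {f_i(x) : i < k} is finite and nonempty, so that its
   supremum is its maximum. *)
Definition Gmax (R : realType) (T : Type) (k : nat)
    (F : 'I_k -> set (T -> R)) : set (T -> R) :=
  [set (fun x => sup (range (fun i => f i x))) | f in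
    [set f : 'I_k -> T -> R | forall i, F i (f i)]].

Definition affine_functions (R : realType) (d : nat) : set ('rV[R]_d -> R) :=
  [set f | exists (w : 'rV[R]_d) (b : R),
    f = (fun x : 'rV[R]_d => \sum_(j < d) w 0 j * x 0 j + b)].
Arguments affine_functions : clear implicits.

(* Main.v *)
(** For every m there are m 2^(m-1) axis-parallel rectangles in the plane such
    that every subfamily is exactly the set of rectangles hit by some 2^m points:
    the rectangles are the switches of a butterfly network and the points are the
    paths routed through it.  The rectangle [x1, x2] x [y1, y2] becomes the vector
    (8^x1, 8^-x2, 8^y1, 8^-y2) of R^4 up to constants, and the point (a, b) the
    affine function 3 - 4 (8^(x1-a-1) + 8^(a-x2-1) + 8^(y1-b-1) + 8^(b-y2-1)),
    which is at least 1 if the point lies in the rectangle and at most -1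
    otherwise.  So the maximum of 2^m affine functions shatters m 2^(m-1) vectors
    in R^4.  As the constant term is always the same, disjoint blocks of 4
    coordinates can be treated independently by the same functions, which gains a
    factor d/4.  On the other side, affine functions have fat-shattering dimension
    at most d + 1, by an affine dependency between the points. *)

Require Import Defs.
From HB Require Import structures.
From mathcomp Require Import all_boot all_order all_algebra.
From mathcomp Require Import all_classical all_reals all_analysis.
From mathcomp Require Import zify ring lra.

Set Implicit Arguments.
Unset Strict Implicit.
Unset Printing Implicit Defensive.

Import Order.TTheory GRing.Theory Num.Theory.

Local Open Scope classical_set_scope.
Local Open Scope ring_scope.

(** * Rectangles and points from a butterfly network *)

(* In the induction step two copies of the configuration sit side by side in x
   and share the y-cells, each cell j being split into 2j and 2j+1.  The new
   rectangle [N, 2N) x {2j} is hit when the right copy takes cell 2j and the left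
   one 2j+1, and missed when they are exchanged; the old rectangles, whose
   y-ranges are unions of whole cells, do not see the exchange. *)
Lemma butterfly_rectangles (m : nat) :
  exists (E : finType) (x1 x2 y1 y2 : E -> nat),
  [/\ (2 * #|E| = m * 2 ^ m)%N,
      forall e, (x2 e < 2 ^ m)%N /\ (y2 e < 2 ^ m)%N
    & forall S : pred E, exists2 f : nat -> nat,
        forall b, (b < 2 ^ m)%N -> (f b < 2 ^ m)%N
      & forall e, S e <-> exists2 b, (b < 2 ^ m)%N &
          [/\ x1 e <= f b <= x2 e & y1 e <= b <= y2 e]%N].
Proof.
elim: m => [|m [E [x1 [x2 [y1 [y2 [cardE bdE shatE]]]]]]].
  exists void, (fun=> 0)%N, (fun=> 0)%N, (fun=> 0)%N, (fun=> 0)%N.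
  by split=> [|[]|S]; [rewrite card_void | exists id => // -[]].
have N2 : (2 ^ m.+1 = 2 * 2 ^ m)%N by rewrite expnS.
set N := (2 ^ m)%N in cardE bdE shatE N2 *.
exists (E + E + 'I_N)%type.
exists (fun e : E + E + 'I_N => match e with
  inl (inl e) => x1 e | inl (inr e) => (N + x1 e) | inr j => N end)%N.
exists (fun e : E + E + 'I_N => match e with
  inl (inl e) => x2 e | inl (inr e) => (N + x2 e) | inr j => (2 * N).-1 end)%N.
exists (fun e : E + E + 'I_N => match e with
  inl (inl e) => 2 * y1 e | inl (inr e) => 2 * y1 e | inr j => 2 * j end)%N.
exists (fun e : E + E + 'I_N => match e with
  inl (inl e) => (2 * y2 e).+1 | inl (inr e) => (2 * y2 e).+1
  | inr j => 2 * j end)%N.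
rewrite N2; split.
- by rewrite !card_sum card_ord; nia.
- by case=> [[e|e]|j]; [have := bdE e | have := bdE e | have := ltn_ord j]; lia.
move=> S.
have [f1 f1N f1P] := shatE (fun e => S (inl (inl e))).
have [f2 f2N f2P] := shatE (fun e => S (inl (inr e))).
(* [s a] says whether the cells 2a and 2a+1 are exchanged: the left copy then sits in cell 2a+1
   instead of 2a. The default [false] only concerns a >= N, beyond all cells. *)
pose s a := if insub a is Some j then S (inr j) else false.
pose f b := (if odd b (+) s b./2 then N + f2 b./2 else f1 b./2)%N.
exists f => [b bN|].
  have bN2 : (b./2 < N)%N by lia.
  by have := f1N _ bN2; have := f2N _ bN2; rewrite /f; case: ifP => _; lia.
have half_lt b : (b < 2 * N -> b./2 < N)%N by lia.
have fL a : f (2 * a + s a)%N = f1 a.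
  by rewrite /f addnC mul2n half_bit_double oddD oddb odd_double addbF addbb.
have fR a : f (2 * a + ~~ s a)%N = (N + f2 a)%N.
  by rewrite /f addnC mul2n half_bit_double oddD oddb odd_double addbF addNb addbb.
case=> [[e|e]|j].
- split=> [/f1P[a aN []]|[b /half_lt bN []]].
    by exists (2 * a + s a)%N; [| rewrite fL; split]; case: (s a); lia.
  rewrite /f; case: ifP => _; first by have := bdE e; lia.
  by move=> *; apply/f1P; exists b./2; last split; lia.
- split=> [/f2P[a aN []]|[b /half_lt bN []]].
    by exists (2 * a + ~~ s a)%N; [| rewrite fR; split]; case: (s a); lia.
  rewrite /f; case: ifP => _; last by have := f1N _ bN; lia.
  by move=> *; apply/f2P; exists b./2; last split; lia.
- have sj : s j = S (inr j) by rewrite /s valK.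
  split=> [Sj|[b /half_lt bN [fb bj]]].
    exists (2 * j)%N; first by have := ltn_ord j; lia.
    have := fR j; rewrite sj Sj addn0 => ->.
    by have := f2N _ (ltn_ord j); lia.
  have {bj} bj : b = (2 * j)%N by lia.
  case Sj : (S (inr j)) => //; move: fb; rewrite bj; have := fL j.
  have := f1N _ (ltn_ord j); rewrite sj Sj addn0; lia.
Qed.

(** * Fat-shattering dimension, and its bounds for affine functions *)

Section FatShattering.
Variables (R : realType) (gamma : R).

(** All thresholds r are 0. Injectivity follows from the margins: signs that differ at two indices
    force different values of f, hence different points. *)
Lemma fat_ge_card (T : Type) (F : set (T -> R)) (I : finType) (p : I -> T) :
    0 < gamma ->
    (forall y : I -> bool,
       exists2 f, F f & forall e, gamma <= (-1) ^+ y e * f (p e)) ->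
  ((#|I|%:R)%:E <= fat gamma F)%E.
Proof.
move=> gamma_gt0 shat; apply: ereal_sup_ubound; exists #|I| => //.
exists (p \o enum_val); split=> [i j /= pij|].
  apply/eqP/negPn/negP => nij.
  have [f _ fP] := shat (fun e => e == enum_val j).
  have := fP (enum_val i); have := fP (enum_val j).
  rewrite eqxx (inj_eq enum_val_inj) (negPf nij) pij expr1 expr0; lra.
apply: (@le_trans _ _ (\big[mine/+oo%E]_(y : {ffun 'I_#|I| -> bool})
  ereal_sup [set \big[mine/+oo%E]_(i < #|I|)
    ((-1) ^+ y i * (f ((p \o enum_val) i) - 0))%:E | f in F])); last first.
  by apply: ereal_sup_ubound; exists (fun=> 0).
apply/bigmin_geP; split=> [|y _]; first by rewrite leey.
have [f Ff fP] := shat (fun e => y (enum_rank e)).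
apply: (le_trans _ (ereal_sup_ubound _)); last by exists f.
apply/bigmin_geP; split=> [|i _]; first by rewrite leey.
by rewrite lee_fin subr0; have := fP (enum_val i); rewrite enum_valK.
Qed.

(** The suprema need not be attained, so the margin is relaxed from gamma to a strict 0, which
    yields actual thresholds and functions. *)
Lemma shattered_sign (T : Type) (F : set (T -> R)) m (x : 'I_m -> T) :
    0 < gamma -> shattered F gamma x ->
  exists r : 'I_m -> R, forall y : {ffun 'I_m -> bool},
    exists2 f, F f & forall i, 0 < (-1) ^+ y i * (f (x i) - r i).
Proof.
move=> gamma_gt0 shat.
have /ereal_sup_gt[_ [r _ <-] /bigmin_gtP[_ rP]] : (0%:E < shatter_margin F x)%E.
  by apply: lt_le_trans shat; rewrite lte_fin.
exists r => y.
have /ereal_sup_gt[_ [f Ff <-] /bigmin_gtP[_ fP]] := rP y isT.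
by exists f => // i; have := fP i isT; rewrite lte_fin.
Qed.

Lemma fat_affine_le d : 0 < gamma ->
  (fat gamma (affine_functions R d) <= (d.+1%:R)%:E)%E.
Proof.
move=> gamma_gt0; apply: ge_ereal_sup => _ [m [x [_ shat]] <-].
rewrite lee_fin ler_nat leqNgt; apply/negP => ltdm.
have [r rP] := shattered_sign gamma_gt0 shat.
(* The column of ones turns a left kernel vector into an affine dependency; it exists because there
   are more than d + 1 rows. *)
pose A : 'M[R]_(m, d + 1) := row_mx (\matrix_(i, j) x i 0 j) (const_mx 1).
have /rowV0Pn[c /sub_kermxP cA c0] : kermx A != 0.
  rewrite kermx_eq0; apply/negP => /eqP rkA.
  by have := rank_leq_col A; rewrite rkA; lia.
have {A cA} [cx c1] : (forall j, \sum_i c 0 i * x i 0 j = 0) /\ \sum_i c 0 i = 0.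
  move: cA; rewrite mul_mx_row => /eqP; rewrite row_mx_eq0.
  move=> /andP[/eqP/matrixP cx /eqP/matrixP c1]; split=> [j|].
    transitivity ((c *m (\matrix_(i, j) x i 0 j)) 0 j); last by rewrite cx mxE.
    by rewrite mxE; apply: eq_bigr => i _; rewrite mxE.
  transitivity ((c *m const_mx 1 : 'M[R]_(1, 1)) 0 0); last by rewrite c1 mxE.
  by rewrite mxE; apply: eq_bigr => i _; rewrite mxE mulr1.
have c_aff f : affine_functions R d f -> \sum_i c 0 i * f (x i) = 0.
  move=> [w [b ->]]; under eq_bigr do rewrite mulrDr mulr_sumr.
  rewrite big_split /= -[X in _ + X]mulr_suml c1 mul0r addr0 exchange_big big1 //= => j _.
  under eq_bigr do rewrite mulrCA.
  by rewrite -mulr_sumr cx mulr0.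
have [i0 ci0] : exists i, c 0 i != 0.
  apply/existsP; apply: contra_neqT c0; rewrite negb_exists => /forallP c0.
  by apply/rowP => i; rewrite mxE; apply/eqP; have := c0 i; rewrite negbK.
(* Signs matched to s * c make every term nonnegative and the one at [i0] positive, while f
   contributes 0 in total. The choices s = 1 and s = -1 then contradict each other. *)
have sgn_sum (y : {ffun 'I_m -> bool}) s :
    (forall i, s * c 0 i = (-1) ^+ y i * `|c 0 i|) ->
    0 < - (s * \sum_i c 0 i * r i).
  move=> yc; have [f /c_aff f0 fP] := rP y.
  have -> : - (s * \sum_i c 0 i * r i) =
      \sum_i `|c 0 i| * ((-1) ^+ y i * (f (x i) - r i)).
    transitivity (s * \sum_i c 0 i * f (x i) - s * \sum_i c 0 i * r i).
      by rewrite f0 mulr0 sub0r.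
    rewrite -mulrBr -sumrB mulr_sumr; apply: eq_bigr => i _.
    by rewrite -mulrBr mulrA yc mulrCA mulrA.
  rewrite (bigD1 i0) //= ltr_pwDl //; first by rewrite mulr_gt0 ?normr_gt0 ?fP.
  by apply: sumr_ge0 => i _; rewrite mulr_ge0 // ltW.
have := sgn_sum [ffun i => c 0 i < 0] 1 _.
have := sgn_sum [ffun i => 0 <= c 0 i] (-1) _.
rewrite !mulN1r mul1r opprK => pos neg.
have : 0 < \sum_i c 0 i * r i.
  by apply: pos => i; rewrite ffunE; case: ger0P; rewrite ?expr0 ?expr1; lra.
have : 0 < - \sum_i c 0 i * r i.
  by apply: neg => i; rewrite ffunE; case: ger0P; rewrite ?expr0 ?expr1; lra.
lra.
Qed.

Lemma fat_affine_ge d : 0 < gamma ->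
  ((d%:R)%:E <= fat gamma (affine_functions R d))%E.
Proof.
move=> gamma_gt0; rewrite -[d in d%:R]card_ord.
apply: (@fat_ge_card _ _ _ (fun i : 'I_d => delta_mx 0 i)) => // y.
exists (fun x => \sum_(j < d) (\row_i ((-1) ^+ y i * gamma)) 0 j * x 0 j + 0).
  by exists (\row_i ((-1) ^+ y i * gamma)), 0.
move=> i; rewrite (bigD1 i) //= big1 => [|j ji].
  by rewrite !mxE !eqxx mulr1 !addr0 mulrA -signr_addb addbb mul1r.
by rewrite !mxE (negPf ji) andbF mulr0.
Qed.

End FatShattering.

(** * From rectangles to maxima of affine functions *)

Lemma sup_range_ge (R : realType) (k : nat) (g : 'I_k -> R) i : g i <= sup (range g).
Proof.
apply: ub_le_sup; last by exists i.
exists (\sum_j `|g j|) => _ [j _ <-].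
by rewrite (bigD1 j) //= (le_trans (ler_norm _)) // lerDl sumr_ge0.
Qed.

Lemma sup_range_le (R : realType) (k : nat) (g : 'I_k -> R) a :
  (0 < k)%N -> (forall i, g i <= a) -> sup (range g) <= a.
Proof.
move=> k0 ga; apply: ge_sup; first by exists (g (Ordinal k0)), (Ordinal k0).
by move=> _ [i _ <-].
Qed.

Lemma sum_block4 (R : realType) (d t : nat) (w : nat -> R) (p : nat -> R) :
  (4 * t + 4 <= d)%N ->
  \sum_(j < d) w j * (if (j %/ 4 == t)%N then p (j %% 4)%N else 0) =
  \sum_(c < 4) w (4 * t + c)%N * p c.
Proof.
move=> td.
rewrite -(big_mkord xpredT
  (fun j => w j * (if (j %/ 4 == t)%N then p (j %% 4)%N else 0))).
rewrite (big_cat_nat _ (n := 4 * t)) //=; last lia.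
rewrite (big_cat_nat _ (m := 4 * t) (n := 4 * t + 4)) //=; last lia.
rewrite big_nat_cond big1 ?add0r => [|j]; last first.
  by case: eqP; rewrite ?mulr0 //; lia.
rewrite addrC big_nat_cond big1 ?add0r => [|j]; last first.
  by case: eqP; rewrite ?mulr0 //; lia.
rewrite -{1}[(4 * t)%N]add0n big_addn addKn big_mkord; apply: eq_bigr => c _.
have -> : ((c + 4 * t) %/ 4 = t)%N by have := ltn_ord c; lia.
have -> : ((c + 4 * t) %% 4 = c)%N by have := ltn_ord c; lia.
by rewrite eqxx addnC.
Qed.

Lemma pow8_ratio_gt0 (R : realType) (a b : nat) : 0 < 8 ^+ a / 8 ^+ b :> R.
Proof. by rewrite divr_gt0 // exprn_gt0. Qed.

(** Base 8 and the extra 1 in the exponent give a sharp threshold: four ratios of at most 1/8 yield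
    at least 3 - 4 * (4/8) = 1, whereas a single ratio of at least 1 already brings the value below
    3 - 4 = -1. *)
Lemma pow8_ratio_le (R : realType) (a b : nat) :
  (a <= b)%N -> 8 ^+ a / 8 ^+ b.+1 <= 8^-1 :> R.
Proof.
move=> ab; rewrite exprS invfM mulrCA ler_piMr ?invr_ge0 //.
by rewrite ler_pdivrMr ?exprn_gt0 // mul1r ler_weXn2l // ler1n.
Qed.

Lemma pow8_ratio_ge (R : realType) (a b : nat) :
  (b < a)%N -> 1 <= 8 ^+ a / 8 ^+ b.+1 :> R.
Proof.
by move=> ba; rewrite ler_pdivlMr ?exprn_gt0 // mul1r ler_weXn2l // ler1n.
Qed.

Lemma affine_max_shatter (R : realType) (gamma : R) (d m : nat) : 0 < gamma ->
  exists (I : finType) (p : I -> 'rV[R]_d),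
    (2 * #|I| = d %/ 4 * (m * 2 ^ m))%N /\
    forall y : I -> bool, exists2 g : nat -> 'rV[R]_d -> R,
      forall b, affine_functions R d (g b)
    & forall e, if y e then forall b, (b < 2 ^ m)%N -> g b (p e) <= - gamma
                else exists2 b, (b < 2 ^ m)%N & gamma <= g b (p e).
Proof.
move=> gamma_gt0.
have [E [x1 [x2 [y1 [y2 [cardE _ shatE]]]]]] := butterfly_rectangles m.
(* Coordinatewise products of [P] and [W] are the four ratios that test x1 <= a, a <= x2, y1 <= b
   and b <= y2. *)
pose P e c : R := nth 0 [:: 8 ^+ x1 e; (8 ^+ (x2 e).+1)^-1;
                            8 ^+ y1 e; (8 ^+ (y2 e).+1)^-1] c.
pose W a b c : R := nth 0 [:: (8 ^+ a.+1)^-1; 8 ^+ a; (8 ^+ b.+1)^-1; 8 ^+ b] c.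
exists ('I_(d %/ 4) * E)%type,
  (fun te : 'I_(d %/ 4) * E =>
    \row_j (if (j %/ 4 == te.1)%N then P te.2 (j %% 4)%N else 0)).
split; first by rewrite card_prod card_ord mulnCA cardE.
move=> y.
(* A true bit stands for the sign -1, so the rectangles to hit are those with [y] false. Each block
   t gets its own routing [f t]. *)
have /choice[f fP] : forall t : 'I_(d %/ 4), exists f : nat -> nat,
    forall e, ~~ y (t, e) <-> exists2 b, (b < 2 ^ m)%N &
      [/\ x1 e <= f b <= x2 e & y1 e <= b <= y2 e]%N.
  by move=> t; have [f _ fP] := shatE (fun e => ~~ y (t, e)); exists f.
(* The last d mod 4 coordinates lie in no block; all points vanish there, so the default [id] is
   arbitrary. *)
pose F j := if insub (j %/ 4)%N is Some t then f t else id.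
pose w b j := - 4 * gamma * W (F j b) b (j %% 4)%N.
exists (fun b x => \sum_(j < d) (\row_i w b i) 0 j * x 0 j + 3 * gamma).
  by move=> b; exists (\row_i w b i), (3 * gamma).
have valE b (t : 'I_(d %/ 4)) e :
    \sum_(j < d) (\row_i w b i) 0 j *
      (\row_i (if (i %/ 4 == t)%N then P e (i %% 4)%N else 0)) 0 j + 3 * gamma
    = gamma * (3 - 4 * (8 ^+ x1 e / 8 ^+ (f t b).+1 + 8 ^+ f t b / 8 ^+ (x2 e).+1
                     + 8 ^+ y1 e / 8 ^+ b.+1 + 8 ^+ b / 8 ^+ (y2 e).+1)).
  under eq_bigr do rewrite !mxE.
  rewrite (sum_block4 (w b) (P e)); last by have := ltn_ord t; lia.
  have wE c : (c < 4)%N -> w b (4 * t + c)%N = - 4 * gamma * W (f t b) b c.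
    move=> c4; rewrite /w /F.
    have -> : ((4 * t + c) %/ 4 = t)%N by lia.
    have -> : ((4 * t + c) %% 4 = c)%N by lia.
    by rewrite valK.
  rewrite !big_ord_recl big_ord0 !wE //= /P /W /=; ring.
move=> [t e] /=; case: ifPn => [yte b bm|/fP[b bm [/andP[h1 h2] /andP[h3 h4]]]].
  rewrite valE.
  have a1 := pow8_ratio_gt0 R (x1 e) (f t b).+1.
  have a2 := pow8_ratio_gt0 R (f t b) (x2 e).+1.
  have a3 := pow8_ratio_gt0 R (y1 e) b.+1.
  have a4 := pow8_ratio_gt0 R b (y2 e).+1.
  rewrite -[- gamma]mulrN1 ler_pM2l //.
  case: (leqP (x1 e) (f t b)) => [h1|/(pow8_ratio_ge R)]; last by lra.
  case: (leqP (f t b) (x2 e)) => [h2|/(pow8_ratio_ge R)]; last by lra.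
  case: (leqP (y1 e) b) => [h3|/(pow8_ratio_ge R)]; last by lra.
  case: (leqP b (y2 e)) => [h4|/(pow8_ratio_ge R)]; last by lra.
  suff : ~~ y (t, e) by rewrite yte.
  by apply/fP; exists b => //; rewrite h1 h2 h3 h4.
exists b => //; rewrite valE -[leLHS]mulr1 ler_pM2l //.
have := pow8_ratio_le R h1; have := pow8_ratio_le R h2.
have := pow8_ratio_le R h3; have := pow8_ratio_le R h4; lra.
Qed.

Lemma fat_Gmax_affine_ge (R : realType) (gamma : R) (k d m : nat) :
    0 < gamma -> (2 ^ m <= k)%N ->
  (((d %/ 4 * (m * 2 ^ m))%N%:R / 2)%:E
    <= fat gamma (Gmax (fun _ : 'I_k => affine_functions R d)))%E.
Proof.
move=> gamma_gt0 mk.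
have [I [p [cardI shat]]] := affine_max_shatter d m gamma_gt0.
rewrite -cardI natrM mulrAC divff ?mul1r //.
apply: (@fat_ge_card _ _ _ _ _ p) => // y.
have [g gA gP] := shat y.
have m0 : (0 < 2 ^ m)%N by rewrite expn_gt0.
(* Reduction modulo 2^m repeats functions to fill all k slots, leaving the maximum unchanged. *)
exists (fun x => sup (range (fun i : 'I_k => g (i %% 2 ^ m)%N x))).
  by exists (fun i => g (i %% 2 ^ m)%N).
move=> e; have := gP e; case: (y e) => [gN|[b bm gb]].
  rewrite expr1 mulN1r lerNr; apply: sup_range_le (leq_trans m0 mk) _ => i.
  by apply: gN; rewrite ltn_mod.
rewrite expr0 mul1r (le_trans gb) //.
have bk : (b < k)%N by lia.
have := sup_range_ge (fun i : 'I_k => g (i %% 2 ^ m)%N (p e)) (Ordinal bk).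
by rewrite /= modn_small.
Qed.

(** * Logarithm estimate and the final constant *)

Lemma ln_nat_le_trunc_log (R : realType) (k : nat) :
  ln k%:R <= (trunc_log 2 k).+1%:R :> R.
Proof.
case: k => [|k]; first by rewrite ln0.
apply: (@le_trans _ _ (ln (2 ^ (trunc_log 2 k.+1).+1)%:R)).
  by rewrite ler_ln ?posrE ?ltr0n ?expn_gt0 // ler_nat ltnW // trunc_log_ltn.
rewrite natrX lnXn // lerMn2r /=.
(* ln(1 + x) <= x at x = 1 bounds ln 2 by 1. *)
by apply: (@le_ln1Dx R 1); lra.
Qed.

Theorem theorem8 (R : realType) :
  exists C : R, 0 < C /\
    forall (k d : nat), (1 <= k)%N -> (4 <= d)%N ->
    let F := fun _ : 'I_k => affine_functions R d in
    forall gamma : R, 0 < gamma ->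
      ((C * ln k%:R)%:E * (\sum_(i < k) fat gamma (F i)) <= fat gamma (Gmax F))%E
      /\ ((C * d%:R * k%:R * ln k%:R)%:E
          <= (C * ln k%:R)%:E * (\sum_(i < k) fat gamma (F i)))%E.
Proof.
(* 64 = 2 * 32: the 2 is the halving in [fat_Gmax_affine_ge], the 32 is the rounding loss in
   [key]. *)
exists (64^-1); split=> [|k d k1 d4 F gamma gamma_gt0]; first by rewrite invr_gt0.
have lnk0 : 0 <= ln k%:R :> R by rewrite ln_ge0 // ler1n.
have Clnk0 : 0 <= 64^-1 * ln k%:R :> R by rewrite mulr_ge0 ?invr_ge0.
split; last first.
  have -> : 64^-1 * d%:R * k%:R * ln k%:R = (64^-1 * ln k%:R) * (k%:R * d%:R) :> R.
    ring.
  rewrite EFinM lee_wpmul2l ?lee_fin //.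
  apply: (@le_trans _ _ (\sum_(i < k) (d%:R)%:E)%E).
    by rewrite sumEFin lee_fin sumr_const card_ord mulr_natl.
  by apply: lee_sum => i _; exact: fat_affine_ge.
pose m := trunc_log 2 k.
have mk : (2 ^ m <= k)%N by rewrite trunc_logP.
apply: le_trans (fat_Gmax_affine_ge d gamma_gt0 mk).
apply: (@le_trans _ _ ((64^-1 * ln k%:R)%:E * (k%:R * d.+1%:R)%:E)%E).
  rewrite lee_wpmul2l ?lee_fin //.
  apply: (@le_trans _ _ (\sum_(i < k) (d.+1%:R)%:E)%E).
    by apply: lee_sum => i _; exact: fat_affine_le.
  by rewrite sumEFin lee_fin sumr_const card_ord mulr_natl.
rewrite -EFinM lee_fin.
(* For k = 1 the bound m + 1 <= 2m fails, as m = 0, but ln 1 = 0. *)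
case: (leqP k 1) => [k1'|k2].
  have -> : k = 1%N by lia.
  by rewrite ln1 mulr0 mul0r divr_ge0.
have m1 : (0 < m)%N by rewrite trunc_log_gt0 /=; lia.
have lnm : ln k%:R <= m.+1%:R :> R := ln_nat_le_trunc_log R k.
have k_lt : (k < 2 * 2 ^ m)%N by rewrite -expnS trunc_log_ltn.
have key : (m.+1 * (k * d.+1) <= 32 * (d %/ 4 * (m * 2 ^ m)))%N.
  (* The factors use m >= 1, k < 2 * 2^m, and d + 1 <= 8 * (d %/ 4) for d >= 4, with equality at d =
     7. *)
  apply: (@leq_trans ((2 * m) * ((2 * 2 ^ m) * (8 * (d %/ 4))))).
    by rewrite !leq_mul //; lia.
  by apply: eq_leq; ring.
suff : ln k%:R * (k%:R * d.+1%:R) <= 32 * (d %/ 4 * (m * 2 ^ m))%N%:R :> R by lra.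
apply: (@le_trans _ _ (m.+1%:R * (k%:R * d.+1%:R))).
  by rewrite ler_wpM2r // mulr_ge0.
by rewrite -!natrM ler_nat.
Qed.
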